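(* For every integer $d\ge4$ there exists a $d$-dimensional integral polytope $\mathcal{P}$ such that the coefficients of $t^{d-2}$ and $t^{d-3}$ in $i(\mathcal{P},t)$ are positive and the coefficient of $t^{j}$ in $i(\mathcal{P},t)$ is negative for all $1\le j<d-3$.
   Context: An integral polytope is a convex polytope all of whose vertices have integer coordinates. For an integral polytope $\mathcal{P}\subseteq\mathbb{R}^N$ of dimension $d$, $i(\mathcal{P},t)=|t\mathcal{P}\cap\mathbb{Z}^N|$ ($t$ a positive integer) is a polynomial in $t$ of degree $d$, the Ehrhart polynomial. *)

(* Defs.v *)
From mathcomp Require Import all_boot all_order all_algebra.
From mathcomp Require Import all_classical reals.

Set Implicit Arguments.
Unset Strict Implicit.
Unset Printing Implicit Defensive.

Import Order.TTheory GRing.Theory Num.Theory.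

Local Open Scope classical_set_scope.
Local Open Scope ring_scope.

Definition affine_hull (R : realType) (N : nat) (A : set 'rV[R]_N) :
    set 'rV[R]_N :=
  [set x | exists k (a : 'I_k -> R) (v : 'I_k -> 'rV[R]_N),
    [/\ forall i, A (v i), \sum_(i < k) a i = 1 &
        x = \sum_(i < k) a i *: v i]].

Definition convex_hull (R : realType) (N : nat) (A : set 'rV[R]_N) :
    set 'rV[R]_N :=
  [set x | exists k (a : 'I_k -> R) (v : 'I_k -> 'rV[R]_N),
    [/\ forall i, A (v i), forall i, 0 <= a i, \sum_(i < k) a i = 1 &
        x = \sum_(i < k) a i *: v i]].

Definition is_polytope (R : realType) (N : nat) (P : set 'rV[R]_N) : Prop :=
  exists2 S : set 'rV[R]_N, finite_set S & P = convex_hull S.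

(* A vertex is an extreme point: it lies in no open segment between two
   distinct points of P. *)
Definition is_vertex (R : realType) (N : nat) (P : set 'rV[R]_N)
    (x : 'rV[R]_N) : Prop :=
  P x /\ forall (y z : 'rV[R]_N) (l : R), P y -> P z -> 0 < l -> l < 1 ->
    x = l *: y + (1 - l) *: z -> y = z.

Definition integer_points (R : realType) (N : nat) : set 'rV[R]_N :=
  [set x | forall j, x ord0 j \is a Num.int].

Definition is_integral_polytope (R : realType) (N : nat)
    (P : set 'rV[R]_N) : Prop :=
  is_polytope P /\ forall x, is_vertex P x -> integer_points x.

(* The dimension of P is that of its affine hull, written as a translate of a
   linear subspace U. The relation never holds for empty P. *)
Definition has_dimension (R : realType) (N : nat) (P : set 'rV[R]_N)
    (d : nat) : Prop :=
  exists (x0 : 'rV[R]_N) (U : {vspace 'rV[R]_N}),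
    affine_hull P = [set x | x - x0 \in U] /\ \dim U = d.

Definition dilate (R : realType) (N : nat) (t : nat) (P : set 'rV[R]_N) :
    set 'rV[R]_N :=
  [set t%:R *: x | x in P].

(* i(P, t) = n; in particular the set of lattice points of t P is finite. *)
Definition ehrhart_count (R : realType) (N : nat) (P : set 'rV[R]_N)
    (t n : nat) : Prop :=
  (dilate t P `&` @integer_points R N #= `I_n)%card.

(* A polynomial is determined by its values at the positive integers, so at
   most one p satisfies this; its coefficients are necessarily rational. *)
Definition is_ehrhart_polynomial (R : realType) (N : nat)
    (P : set 'rV[R]_N) (p : {poly rat}) : Prop :=
  forall t : nat, (0 < t)%N ->
    exists2 n : nat, ehrhart_count P t n & p.[t%:R] = n%:R.

(* Main.v *)
(**
The coefficient signs come from products [Q x [0, n]^e] with [e = d - 3], where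
[Q] is the Minkowski sum of a Reeve tetrahedron of height [m = 6 M] and a
vertical segment of length [c]: over the unit square, [Q] lies between
[m max (0, x + y - 1)] and [c + m min (x, y)].  Its Ehrhart polynomial is
[(t + 1)^2 (1 + c t) + M (t^3 - t) = 1 + f1 t + f2 t^2 + f3 t^3] with
[f1 = 2 + c - M], [f2 = 1 + 2 c], [f3 = c + M].  Multiplying by [(n t + 1)^e],
the coefficient of [t^j] is
[sum_i f_i 'C(e, j - i) n^(j - i)], and the decisive comparison is between the
terms [i = 1] (negative, [f1 = - C]) and [i = 2].  Their ratio
[f2 'C(e, j - 2) / (C n 'C(e, j - 1))] increases with [j], so the sign changes
exactly between [j = e - 1] and [j = e] if [f2 / (C n)] lies between
[2 / (e - 1)] and [3 / (e - 2)].  We take [C = (e - 1) n^2] and [c = n^3], so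
that it is just above [2 / (e - 1)]; [n = 6 e^2] makes the terms [i = 0] and
[i = 3] negligible.  When [d = 4] a cube suffices.
*)
Require Import Defs.
From mathcomp Require Import all_boot all_order all_algebra.
From mathcomp Require Import all_classical reals.
From mathcomp Require Import ring lra zify.

Set Implicit Arguments.
Unset Strict Implicit.
Unset Printing Implicit Defensive.

Import Order.TTheory GRing.Theory Num.Theory.

Local Open Scope classical_set_scope.
Local Open Scope ring_scope.

(** * Finite cardinals as ranges of injections *)

Lemma card_range_inj (T : finType) (U : Type) (f : T -> U) :
  injective f -> (range f #= `I_#|T|)%card.
Proof.
move=> f_inj; apply: (card_eq_trans (B := [set: T])).
  by apply: inj_card_eq => x y _ _; apply: f_inj.
rewrite card_eq_sym.
have -> : `I_#|T| = range (fun x : T => enum_rank x : nat).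
  apply/seteqP; split=> [i /= lt_iT | _ [x _ <-] /=]; last exact: ltn_ord.
  by exists (enum_val (Ordinal lt_iT)); rewrite ?enum_valK.
by apply: inj_card_eq => x y _ _ /val_inj/enum_rank_inj.
Qed.

Lemma card_II_range (U : Type) (A : set U) (n : nat) :
  (A #= `I_n)%card -> exists2 f : 'I_n -> U, injective f & range f = A.
Proof.
rewrite card_eq_sym => /card_bijP[f [g fK gK]].
exists (fun i : 'I_n => set_val (f (SigSub (mem_set (ltn_ord i : `I_n i))))).
  by move=> i j /val_inj/(can_inj fK)/(congr1 set_val) eq_ij; apply: val_inj.
apply/seteqP; split=> [_ [i _ <-]|x Ax].
  exact: set_mem (valP _).
have lt_gn := set_mem (valP (g (SigSub (mem_set Ax)))).
exists (Ordinal lt_gn) => //.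
by rewrite (_ : SigSub _ = g (SigSub (mem_set Ax))) ?gK//; apply/val_inj.
Qed.

(** * Affine and convex hulls, and extreme points *)

Section Hulls.

Context {R : realType} {N : nat}.
Implicit Types (A B : set 'rV[R]_N) (x : 'rV[R]_N).

(** Arbitrary finite index types let later combinations run over pairs or boolean triples without
    renumbering. *)
Lemma affine_hull_fin (T : finType) (a : T -> R) (v : T -> 'rV[R]_N) A :
    (forall i, A (v i)) -> \sum_i a i = 1 ->
  affine_hull A (\sum_i a i *: v i).
Proof.
move=> Av a1; exists #|T|, (a \o enum_val), (v \o enum_val).
by split=> //=; rewrite -?a1 (reindex _ (onW_bij _ (@enum_val_bij T))).
Qed.

Lemma convex_hull_fin (T : finType) (a : T -> R) (v : T -> 'rV[R]_N) A :
    (forall i, A (v i)) -> (forall i, 0 <= a i) -> \sum_i a i = 1 ->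
  convex_hull A (\sum_i a i *: v i).
Proof.
move=> Av a0 a1; exists #|T|, (a \o enum_val), (v \o enum_val).
by split=> //=; rewrite -?a1 (reindex _ (onW_bij _ (@enum_val_bij T))).
Qed.

Lemma sub_convex_hull A : A `<=` convex_hull A.
Proof.
move=> x Ax; have := @convex_hull_fin unit (fun=> 1) (fun=> x) A.
by rewrite !big_const !card_unit /= addr0 scale1r addr0; apply.
Qed.

Lemma sub_affine_hull A B : A `<=` B -> affine_hull A `<=` affine_hull B.
Proof.
move=> AB x [k [a [v [Av a1 ->]]]].
by exists k, a, v; split=> // i; apply: AB.
Qed.

(** Since the weights sum to 1, an affine functional sends a convex combination to the same
    combination of its values. *)
Lemma convex_hull_ge0 A (u : 'I_N -> R) (b : R) :
    (forall x, A x -> 0 <= b + \sum_j u j * x 0 j) ->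
  forall x, convex_hull A x -> 0 <= b + \sum_j u j * x 0 j.
Proof.
move=> uA x [k [a [v [Av a0 a1 ->]]]].
have -> : b + \sum_j u j * (\sum_(i < k) a i *: v i) 0 j =
    \sum_(i < k) a i * (b + \sum_j u j * v i 0 j).
  under [RHS]eq_bigr do rewrite mulrDr.
  rewrite big_split -mulr_suml a1 mul1r; congr (_ + _).
  under [RHS]eq_bigr do rewrite mulr_sumr.
  rewrite exchange_big; apply: eq_bigr => j _.
  by rewrite summxE mulr_sumr; apply: eq_bigr => i _; rewrite mxE mulrCA.
by apply: sumr_ge0 => i _; apply: mulr_ge0; [apply: a0 | apply/uA/Av].
Qed.

(** Some weight [a i] is nonzero. If it is 1, then [x = v i]. Otherwise [x] lies strictly between
    [v i] and the normalised combination of the other points; extremality makes these two equal, so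
    again [x = v i]. *)
Lemma vertex_convex_hull A x : is_vertex (convex_hull A) x -> A x.
Proof.
move=> [[k [a [v [Av a0 a1 def_x]]]] ext_x].
have [i ai_neq0] : exists i, a i != 0.
  apply: contrapT => a_eq0; move/eqP: a1; rewrite big1 ?(eq_sym 0) ?oner_eq0//.
  by move=> i _; apply/eqP/negPn/negP => ai; apply: a_eq0; exists i.
have ai_gt0 : 0 < a i by rewrite lt_neqAle eq_sym ai_neq0 a0.
have sum_rest : \sum_(j < k | j != i) a j = 1 - a i.
  by rewrite -a1 [in RHS](bigD1 i)//= addrAC subrr add0r.
have rest_ge0 : 0 <= 1 - a i by rewrite -sum_rest sumr_ge0.
have [ai1|ai1] := eqVneq (a i) 1.
  have a_eq0 j : j != i -> a j = 0.
    apply/(psumr_eq0P (P := fun j => j != i)) => [m _ //|].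
    by rewrite sum_rest ai1 subrr.
  rewrite def_x (bigD1 i)//= ai1 scale1r big1 ?addr0// => j /a_eq0->.
  by rewrite scale0r.
have rest_gt0 : 0 < 1 - a i.
  by rewrite lt_neqAle rest_ge0 eq_sym subr_eq0 eq_sym ai1.
(* Index [i] is kept with weight 0, so that sums still run over all of ['I_k]. *)
pose b j := if j == i then 0 else a j / (1 - a i).
(* Stated for any module: [R^o] yields the total weight, row vectors the combination itself. *)
have sum_b (V : lmodType R) (w : 'I_k -> V) :
    \sum_j b j *: w j = (1 - a i)^-1 *: \sum_(j < k | j != i) a j *: w j.
  rewrite (bigD1 i)//= /b eqxx scale0r add0r scaler_sumr.
  by apply: eq_bigr => j /negPf->; rewrite scalerA mulrC.
have b1 : \sum_j b j = 1.
  have := sum_b R^o (fun=> 1).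
  under eq_bigr do rewrite /GRing.scale/= mulr1.
  under [in RHS]eq_bigr do rewrite /GRing.scale/= mulr1.
  by rewrite sum_rest => ->; rewrite [LHS]mulVf ?gt_eqF.
have b0 j : 0 <= b j by rewrite /b; case: ifP => // _; rewrite divr_ge0.
have def_x' : x = a i *: v i + (1 - a i) *: \sum_j b j *: v j.
  by rewrite sum_b scalerA mulfV ?gt_eqF// scale1r def_x (bigD1 i).
have eq_vi : v i = \sum_j b j *: v j.
  apply: ext_x ai_gt0 _ def_x'; first exact: sub_convex_hull.
    exact: convex_hull_fin.
  by rewrite -subr_gt0.
by rewrite def_x' -eq_vi -scalerDl addrC subrK scale1r.
Qed.

End Hulls.

(** The invariant carried through products: finitely many lattice points generate the polytope
    convexly and the whole space affinely. It spares any computation of vertices or dimensions of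
    the products. *)
Definition spanning_lattice_polytope (R : realType) (N : nat)
    (P : set 'rV[R]_N) (p : {poly rat}) : Prop :=
  is_ehrhart_polynomial P p /\
  exists S, [/\ finite_set S, S `<=` @integer_points R N, P = convex_hull S &
                affine_hull S = setT].

Lemma spanning_lattice_polytopeP (R : realType) (N : nat)
    (P : set 'rV[R]_N) (p : {poly rat}) :
    spanning_lattice_polytope P p ->
  [/\ is_integral_polytope P, has_dimension P N & is_ehrhart_polynomial P p].
Proof.
move=> [ehrP [S [finS intS defP affS]]]; split=> //.
  split; first by exists S.
  by rewrite defP => x /vertex_convex_hull/intS.
exists 0, fullv; split; last by rewrite dimvf /dim /= mul1n.
apply/seteqP; split=> [x _ /=|x _]; first by rewrite memvf.
apply: (sub_affine_hull (A := S)); last by rewrite affS.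
by rewrite defP; apply: sub_convex_hull.
Qed.

(** * Row vectors with a prepended coordinate *)

Section ConsRow.

Context {R : realType} {N : nat}.
Implicit Types (y : R) (x : 'rV[R]_N) (z : 'rV[R]_(1 + N)).

Definition cons_row y x : 'rV[R]_(1 + N) := row_mx y%:M x.

Lemma cons_row0 y x : cons_row y x 0 0 = y.
Proof. by rewrite mxE; case: splitP => // j _; rewrite (ord1 j) mxE mulr1n. Qed.

Lemma rsubmx_cons_row y x : rsubmx (cons_row y x) = x.
Proof. exact: row_mxKr. Qed.

Lemma cons_rowK z : cons_row (z 0 0) (rsubmx z) = z.
Proof.
rewrite -[RHS]hsubmxK; congr (row_mx _ _).
apply/rowP => j; rewrite !mxE (ord1 j) mulr1n; congr (z _ _).
exact/val_inj.
Qed.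

Lemma cons_row_inj y y' x x' :
  cons_row y x = cons_row y' x' -> y = y' /\ x = x'.
Proof.
move=> eq_yx; split; last by rewrite -(rsubmx_cons_row y x) eq_yx row_mxKr.
by rewrite -(cons_row0 y x) eq_yx cons_row0.
Qed.

Lemma scale_cons_row a y x : a *: cons_row y x = cons_row (a * y) (a *: x).
Proof. by rewrite /cons_row scale_row_mx scale_scalar_mx. Qed.

Lemma sum_cons_row (I : finType) (y : I -> R) (x : I -> 'rV[R]_N) :
  \sum_i cons_row (y i) (x i) = cons_row (\sum_i y i) (\sum_i x i).
Proof.
rewrite -[LHS]cons_rowK summxE linear_sum /=; congr cons_row.
  by apply: eq_bigr => i _; rewrite cons_row0.
by apply: eq_bigr => i _; rewrite rsubmx_cons_row.
Qed.

Lemma integer_points_cons_row y x :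
  @integer_points R _ (cons_row y x) <-> y \is a Num.int /\ integer_points x.
Proof.
split=> [intyx|[inty intx] j].
  split; first by rewrite -(cons_row0 y x); apply: intyx.
  by move=> j; rewrite -(rsubmx_cons_row y x) mxE; apply: intyx.
rewrite mxE; case: splitP => i _ //.
by rewrite (ord1 i) mxE mulr1n.
Qed.

End ConsRow.

(** * Products with the segment from 0 to [n] *)

Section Prism.

Context {R : realType} {N : nat} (n : nat).
Hypothesis n_gt0 : (0 < n)%N.
Implicit Types (S P : set 'rV[R]_N) (y : R) (x : 'rV[R]_N) (z : 'rV[R]_(1 + N)).

Definition prism_vertices S : set 'rV[R]_(1 + N) :=
  [set cons_row (b%:R * n%:R) x | b in [set: bool] & x in S].

(** Barycentric coordinates of [y] with respect to the endpoints [n] (for [true]) and 0 (for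
    [false]). *)
Let weight y (b : bool) : R := if b then y / n%:R else 1 - y / n%:R.

Let weight_sum k (a : 'I_k -> R) y : \sum_i a i = 1 ->
  \sum_(ib : 'I_k * bool) a ib.1 * weight y ib.2 = 1.
Proof.
move=> a1; rewrite -(pair_bigA _ (fun i b => a i * weight y b))/= -[RHS]a1.
by apply: eq_bigr => i _; rewrite big_bool /= -mulrDr /weight addrC subrK mulr1.
Qed.

(** Product weights, with arbitrary real [a] and [y], so that the identity serves convex and affine
    hulls alike. *)
Let weight_comb k (a : 'I_k -> R) (v : 'I_k -> 'rV[R]_N) y :
    \sum_i a i = 1 ->
  \sum_(ib : 'I_k * bool)
     (a ib.1 * weight y ib.2) *: cons_row (ib.2%:R * n%:R) (v ib.1) =
  cons_row y (\sum_i a i *: v i).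
Proof.
move=> a1; have n0 : n%:R != 0 :> R by rewrite pnatr_eq0 -lt0n.
rewrite -(pair_bigA _ (fun i (b : bool) =>
  (a i * weight y b) *: cons_row (b%:R * n%:R) (v i)))/=.
transitivity (\sum_i cons_row (a i * y) (a i *: v i)).
  apply: eq_bigr => i _; rewrite big_bool /= !scale_cons_row.
  rewrite /cons_row add_row_mx -scalerDl -mulrDr -raddfD /= /weight.
  rewrite (addrC (y / _)) subrK mulr1 mul0r mulr0 addr0 mul1r.
  congr (row_mx _%:M _).
  by rewrite -mulrA divfK.
by rewrite sum_cons_row -mulr_suml a1 mul1r.
Qed.

Lemma convex_hull_prismP S z :
  convex_hull (prism_vertices S) z <->
  0 <= z 0 0 <= n%:R /\ convex_hull S (rsubmx z).
Proof.
split=> [[k [a [v [Av a0 a1 ->]]]]|[/andP[z0 zn] [k [a [v [Av a0 a1 def_z]]]]]].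
  have v00 i : 0 <= v i 0 0 <= n%:R.
    have [[] _ [x _ <-]] := Av i; rewrite cons_row0.
      by rewrite mul1r ler0n lexx.
    by rewrite mul0r lexx ler0n.
  rewrite summxE; split.
    apply/andP; split.
      apply: sumr_ge0 => i _; rewrite mxE mulr_ge0//.
      by have /andP[] := v00 i.
    rewrite -[leRHS]mul1r -[X in X * _]a1 mulr_suml; apply: ler_sum => i _.
    by rewrite mxE ler_wpM2l//; have /andP[] := v00 i.
  rewrite linear_sum; exists k, a, (rsubmx \o v); split=> //.
    by move=> i /=; have [b _ [x Sx <-]] := Av i; rewrite rsubmx_cons_row.
  by apply: eq_bigr => i _; rewrite linearZ.
rewrite -(cons_rowK z) def_z -weight_comb//; apply: convex_hull_fin.
- by move=> [i b] /=; exists b => //; exists (v i).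
- move=> [i b]; rewrite /= /weight mulr_ge0//; case: ifP => _.
    by rewrite divr_ge0.
  by rewrite subr_ge0 ler_pdivrMr ?ltr0n// mul1r.
- exact: weight_sum.
Qed.

Lemma affine_hull_prism S :
  affine_hull S = setT -> affine_hull (prism_vertices S) = setT.
Proof.
move=> affS; apply/seteqP; split=> // z _.
have [k [a [v [Av a1 def_z]]]] : affine_hull S (rsubmx z) by rewrite affS.
rewrite -(cons_rowK z) def_z -weight_comb//.
apply: affine_hull_fin; last exact: weight_sum.
by move=> [i b] /=; exists b => //; exists (v i).
Qed.

(** Lattice points of the [t]-th dilate are pairs of a lattice point of the dilated base and an
    integer from 0 to [n * t], so the count is multiplied by [n * t + 1]. *)
Lemma ehrhart_prism S (p : {poly rat}) :
    is_ehrhart_polynomial (convex_hull S) p ->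
  is_ehrhart_polynomial (convex_hull (prism_vertices S)) (p * (n%:R *: 'X + 1)).
Proof.
move=> ehrS t t_gt0; have [a /card_II_range[f f_inj rgf] pa] := ehrS t t_gt0.
exists (a * (n * t).+1)%N; last first.
  by rewrite hornerM pa hornerD hornerZ hornerX hornerC natrM -natr1 natrM.
pose F (ij : 'I_a * 'I_(n * t).+1) : 'rV[R]_(1 + N) := cons_row ij.2%:R (f ij.1).
have t0 : t%:R != 0 :> R by rewrite pnatr_eq0 -lt0n.
have tP : 0 < t%:R :> R by rewrite ltr0n.
rewrite /ehrhart_count.
suff -> : dilate t (convex_hull (prism_vertices S)) `&` @integer_points R (1 + N)
    = range F.
  rewrite -[X in (_ #= `I_X)%card](_ : #|{: 'I_a * 'I_(n * t).+1}| = _);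
    last by rewrite card_prod !card_ord.
  apply: card_range_inj => -[i j] [i' j'] /cons_row_inj[/= /eqP + /f_inj->].
  rewrite eqr_nat => /eqP eqj.
  by congr (_, _); apply: val_inj.
apply/seteqP; split=> [z [[w /convex_hull_prismP[w0 Sw] def_z] intz]|_ [[i j] _ <-]].
  have [m def_m] : exists m, z 0 0 = m%:R.
    apply/natrP; rewrite natrEint intz -def_z mxE mulr_ge0//.
    by case/andP: w0.
  have lt_m : (m < (n * t).+1)%N.
    rewrite ltnS -(ler_nat R) -def_m -def_z mxE natrM mulrC.
    by rewrite ler_wpM2r//; case/andP: w0.
  have [i _ fi] : range f (rsubmx z).
    rewrite rgf; split.
      by exists (rsubmx w) => //; rewrite -def_z linearZ.
    by move=> j; rewrite mxE; apply: intz.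
  by exists (i, Ordinal lt_m) => //; rewrite -[RHS]cons_rowK /F /= fi def_m.
have [[x Sx xf] intf] : (dilate t (convex_hull S) `&` @integer_points R N) (f i).
  by rewrite -rgf; exists i.
split.
  exists (t%:R^-1 *: F (i, j)); last by rewrite scalerA mulfV// scale1r.
  apply/convex_hull_prismP; split; last first.
    by rewrite linearZ /= rsubmx_cons_row -xf scalerA mulVf// scale1r.
  rewrite mxE cons_row0 /=.
  rewrite mulr_ge0 ?invr_ge0//= mulrC ler_pdivrMr// -natrM ler_nat -ltnS.
  exact: ltn_ord.
by apply/integer_points_cons_row; split=> //; apply: natr_int.
Qed.

Lemma spanning_lattice_polytope_prism P (p : {poly rat}) :
    spanning_lattice_polytope P p ->
  exists Q : set 'rV[R]_(1 + N),
    spanning_lattice_polytope Q (p * (n%:R *: 'X + 1)).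
Proof.
move=> [ehrP [S [finS intS defP affS]]]; rewrite defP in ehrP.
exists (convex_hull (prism_vertices S)); split; first exact: ehrhart_prism.
exists (prism_vertices S); split=> //; last exact: affine_hull_prism.
  by apply: finite_image2.
move=> _ [b _ [x Sx <-]]; apply/integer_points_cons_row.
by split; [rewrite -natrM natr_int | apply: intS].
Qed.

End Prism.

Lemma spanning_lattice_polytope_prisms (R : realType) (N n e : nat)
    (P : set 'rV[R]_N) (p : {poly rat}) : (0 < n)%N ->
    spanning_lattice_polytope P p ->
  exists Q : set 'rV[R]_(e + N),
    spanning_lattice_polytope Q (p * (n%:R *: 'X + 1) ^+ e).
Proof.
move=> n_gt0 slP; elim: e => [|e [Q slQ]].
  by exists P; rewrite mulr1.
have [Q' slQ'] := spanning_lattice_polytope_prism n_gt0 slQ.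
(* [1 + (e + N)] and [e.+1 + N] are convertible, so the row type needs no cast. *)
by exists Q'; rewrite exprSr mulrA.
Qed.

(** * Sums over a square of lattice points *)

Section SquareSums.

Local Open Scope nat_scope.

Lemma sum_ord_double (n : nat) : 2 * (\sum_(i < n.+1) i) = n * n.+1.
Proof.
elim: n => [|n IHn]; first by rewrite big_ord1.
by rewrite big_ord_recr /= mulnDr IHn; lia.
Qed.

Lemma sum_square_recr (F : nat -> nat -> nat) (n : nat) :
  \sum_(x < n.+1) \sum_(y < n.+1) F x y =
  \sum_(x < n) \sum_(y < n) F x y + \sum_(x < n) F x n + \sum_(y < n) F n y
  + F n n.
Proof.
rewrite big_ord_recr /= big_ord_recr /= addnA; congr (_ + _ + _).
by rewrite -big_split; apply: eq_bigr => x _; rewrite big_ord_recr.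
Qed.

(** Passing from [n] to [n + 1] adds a row, a column and a corner, together [(n + 1)^2]. *)
Lemma sum_minn_square (n : nat) :
  6 * (\sum_(x < n.+1) \sum_(y < n.+1) minn x y) = n * n.+1 * (2 * n).+1.
Proof.
elim: n => [|n IHn]; first by rewrite !big_ord1.
rewrite sum_square_recr minnn.
have min_id F : F =1 (fun x : 'I_n.+1 => x : nat) ->
    2 * (\sum_(x < n.+1) F x) = n * n.+1.
  by move=> eqF; rewrite (eq_bigr _ (fun i _ => eqF i)) sum_ord_double.
have E1 := min_id (fun x => minn x n.+1) (fun x => minn_idPl (ltnW (ltn_ord x))).
have E2 := min_id (fun x => minn n.+1 x) (fun x => minn_idPr (ltnW (ltn_ord x))).
by move: IHn E1 E2; nia.
Qed.

(** Of the new row and column, one vanishes by truncation and the other adds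
    [(n + 1) (n + 2) / 2]. *)
Lemma sum_subn_square (n : nat) :
  6 * (\sum_(x < n.+1) \sum_(y < n.+1) (y - x)) = n * n.+1 * n.+2.
Proof.
elim: n => [|n IHn]; first by rewrite !big_ord1.
rewrite (sum_square_recr (fun x y => y - x)) subnn.
have E1 : \sum_(y < n.+1) (y - n.+1) = 0.
  by apply: big1 => y _; have := ltn_ord y; lia.
have E2 : \sum_(x < n.+1) (n.+1 - x) + \sum_(i < n.+1) i = n.+1 * n.+1.
  rewrite -big_split (eq_bigr (fun=> n.+1)) => [|x _ /=]; last first.
    by rewrite subnK // ltnW.
  by rewrite sum_nat_const card_ord.
have E3 := sum_ord_double n.
by move: IHn E1 E2 E3; nia.
Qed.

(* With [x] reversed to [t - x], the sum of [x + y - t] becomes that of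
   [y - x]. *)
Lemma sum_height_square (t : nat) :
  6 * (\sum_(x < t.+1) \sum_(y < t.+1) (minn x y - (x + y - t))) + t = t ^ 3.
Proof.
have rev_sum : \sum_(x < t.+1) \sum_(y < t.+1) (x + y - t) =
    \sum_(x < t.+1) \sum_(y < t.+1) (y - x).
  rewrite (reindex_inj rev_ord_inj); apply: eq_bigr => x _.
  by apply: eq_bigr => y _ /=; have := ltn_ord x; lia.
(* On the square [x + y - t <= minn x y], so the truncated difference is exact. *)
have split_min : \sum_(x < t.+1) \sum_(y < t.+1) (minn x y - (x + y - t)) +
    \sum_(x < t.+1) \sum_(y < t.+1) (x + y - t) =
    \sum_(x < t.+1) \sum_(y < t.+1) minn x y.
  rewrite -big_split; apply: eq_bigr => x _ /=.
  rewrite -big_split; apply: eq_bigr => y _ /=.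
  by have := ltn_ord x; have := ltn_ord y; lia.
move: (sum_minn_square t) (sum_subn_square t).
rewrite -split_min -rev_sum; set G := \sum_(x < _) _; set B := \sum_(x < _) _.
by rewrite !expnS; nia.
Qed.

End SquareSums.

(** * The Reeve prism: vertices and inequalities *)

Section ReevePrism.

Context {R : realType} (c m : nat).
Hypothesis c_gt0 : (0 < c)%N.
Implicit Types (x y z w s : R) (v : 'rV[R]_3).

Definition point3 x y z : 'rV[R]_3 := \row_j [:: x; y; z]`_j.

Lemma point3K v : point3 (v 0 0) (v 0 1) (v 0 2) = v.
Proof.
by apply/rowP => -[[|[|[|//]]] lt_j3]; rewrite mxE /=;
  congr (v _ _); apply/val_inj.
Qed.

Lemma scale_point3 a x y z : a *: point3 x y z = point3 (a * x) (a * y) (a * z).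
Proof. by apply/rowP => -[[|[|[|//]]] lt_j3]; rewrite !mxE. Qed.

(** [b.1] picks a corner of the unit square and [b.2] the lower or upper copy of the tetrahedron. *)
Definition reeve_vertex (b : bool * bool * bool) : 'rV[R]_3 :=
  point3 b.1.1%:R b.1.2%:R (m%:R * (b.1.1 && b.1.2)%:R + c%:R * b.2%:R).

Definition reeve_prism : set 'rV[R]_3 := convex_hull (range reeve_vertex).

Definition reeve_region x y z : Prop :=
  [/\ 0 <= x <= 1, 0 <= y <= 1, 0 <= z, m%:R * (x + y - 1) <= z &
      z <= c%:R + m%:R * x /\ z <= c%:R + m%:R * y].

Lemma sum_bool3 (V : nmodType) (F : bool * bool * bool -> V) :
  \sum_b F b = F (true, true, true) + F (true, true, false)
  + F (true, false, true) + F (true, false, false)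
  + F (false, true, true) + F (false, true, false)
  + F (false, false, true) + F (false, false, false).
Proof.
rewrite (eq_bigr (fun b => F (b.1, b.2))) => [|[] //].
rewrite -(pair_bigA _ (fun p b => F (p, b)))/=.
rewrite (eq_bigr (fun p => \sum_b F ((p.1, p.2), b))) => [|[] //].
rewrite -(pair_bigA _ (fun p q => \sum_b F ((p, q), b)))/=.
by rewrite !big_bool /= !addrA.
Qed.

(* [w] is the weight of the corner [(1, 1)] of the square, [s] that of the
   upper copy. *)
Definition reeve_weight x y w s (b : bool * bool * bool) : R :=
  (match b.1 with
   | (true, true) => w
   | (true, false) => x - w
   | (false, true) => y - w
   | (false, false) => 1 - x - y + w
   end) * (if b.2 then s else 1 - s).

Lemma sum_reeve_weight x y w s : \sum_b reeve_weight x y w s b = 1.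
Proof. by rewrite sum_bool3 /reeve_weight /=; ring. Qed.

(** An identity in four free parameters: nonnegative weights give the convex hull, arbitrary ones
    the affine hull. *)
Lemma reeve_comb x y w s :
  \sum_b reeve_weight x y w s b *: reeve_vertex b =
  point3 x y (m%:R * w + c%:R * s).
Proof.
rewrite sum_bool3 /reeve_weight /reeve_vertex /=.
by apply/rowP => -[[|[|[|//]]] lt_j3]; rewrite !mxE /=; ring.
Qed.

(** Each inequality is affine and holds at the eight vertices, hence on their hull. Conversely, the
    weights are nonnegative once [w] lies between [max (0, x + y - 1)] and [min (x, y)] and [s]
    between 0 and 1; such a pair reaching height [z] is constructed. *)
Lemma reeve_prismP x y z : reeve_prism (point3 x y z) <-> reeve_region x y z.
Proof.
split=> [Pxyz | [/andP[x0 x1] /andP[y0 y1] z0 zlo [zx zy]]].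
  have ineq (b u0 u1 u2 : R) :
      (forall i, 0 <= b + (u0 * reeve_vertex i 0 0 + u1 * reeve_vertex i 0 1
                           + u2 * reeve_vertex i 0 2)) ->
      0 <= b + (u0 * x + u1 * y + u2 * z).
    move=> ge0; have := @convex_hull_ge0 R 3 (range reeve_vertex)
      (fun j => [:: u0; u1; u2]`_j) b _ _ Pxyz.
    rewrite !big_ord_recr big_ord0 /= !mxE /= add0r; apply=> _ [i _ <-].
    rewrite !big_ord_recr big_ord0 /= add0r.
    by have := ge0 i; rewrite !mxE.
  have m0 : 0 <= m%:R :> R by [].
  have c0 : 0 <= c%:R :> R by [].
  have x0 : 0 <= x.
    suff : 0 <= 0 + (1 * x + 0 * y + 0 * z) by lra.
    by apply: ineq => -[[[] []] []]; rewrite !mxE /=; lra.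
  have x1 : x <= 1.
    suff : 0 <= 1 + (-1 * x + 0 * y + 0 * z) by lra.
    by apply: ineq => -[[[] []] []]; rewrite !mxE /=; lra.
  have y0 : 0 <= y.
    suff : 0 <= 0 + (0 * x + 1 * y + 0 * z) by lra.
    by apply: ineq => -[[[] []] []]; rewrite !mxE /=; lra.
  have y1 : y <= 1.
    suff : 0 <= 1 + (0 * x + -1 * y + 0 * z) by lra.
    by apply: ineq => -[[[] []] []]; rewrite !mxE /=; lra.
  have z0 : 0 <= z.
    suff : 0 <= 0 + (0 * x + 0 * y + 1 * z) by lra.
    by apply: ineq => -[[[] []] []]; rewrite !mxE /=; lra.
  have zlo : m%:R * (x + y - 1) <= z.
    suff : 0 <= m%:R + (- m%:R * x + - m%:R * y + 1 * z) by lra.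
    by apply: ineq => -[[[] []] []]; rewrite !mxE /=; lra.
  have zx : z <= c%:R + m%:R * x.
    suff : 0 <= c%:R + (m%:R * x + 0 * y + -1 * z) by lra.
    by apply: ineq => -[[[] []] []]; rewrite !mxE /=; lra.
  have zy : z <= c%:R + m%:R * y.
    suff : 0 <= c%:R + (0 * x + m%:R * y + -1 * z) by lra.
    by apply: ineq => -[[[] []] []]; rewrite !mxE /=; lra.
  by split=> //; apply/andP; split.
pose lo := Num.max 0 (x + y - 1); pose hi := Num.min x y.
have lo0 : 0 <= lo by rewrite /lo le_max lexx.
have lo1 : x + y - 1 <= lo by rewrite /lo le_max lexx orbT.
have hix : hi <= x by rewrite /hi ge_min lexx.
have hiy : hi <= y by rewrite /hi ge_min lexx orbT.
have lohi : lo <= hi.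
  rewrite /lo /hi ge_max !le_min x0 y0 /=.
  by apply/andP; split; lra.
have mlo : m%:R * lo <= z by rewrite /lo; case: (leP 0) => _; rewrite ?mulr0.
have mhi : z <= c%:R + m%:R * hi by rewrite /hi; case: (leP x y).
have c0 : 0 < c%:R :> R by rewrite ltr0n.
pose gap : R := m%:R * (hi - lo) + c%:R.
have gap0 : 0 < gap by rewrite ltr_wpDl// mulr_ge0// subr_ge0.
(* As [s] runs from 0 to 1 and [w] from [lo] to [hi] in step, the height grows linearly from
   [m * lo] to [m * hi + c]; this [s] is where it equals [z]. *)
pose s := (z - m%:R * lo) / gap.
have s0 : 0 <= s by rewrite /s divr_ge0 ?subr_ge0// ltW.
have s1 : s <= 1 by rewrite /s ler_pdivrMr// mul1r /gap; lra.
pose w := lo + s * (hi - lo).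
have w_lo : lo <= w by rewrite /w lerDl mulr_ge0// subr_ge0.
have w_hi : w <= hi by rewrite /w -lerBrDl ler_piMl ?subr_ge0.
have -> : z = m%:R * w + c%:R * s.
  transitivity (m%:R * lo + s * gap); last by rewrite /w /gap; ring.
  by rewrite /s divfK ?gt_eqF// addrC subrK.
rewrite -reeve_comb; apply: convex_hull_fin; first by move=> b; exists b.
  by move=> [[[] []] []] /=; apply: mulr_ge0 => /=; lra.
exact: sum_reeve_weight.
Qed.

Lemma affine_hull_reeve : affine_hull (range reeve_vertex) = setT.
Proof.
apply/seteqP; split=> // v _.
rewrite -(point3K v).
(* With [w = 0], the parameter [s = z / c] reaches any height [z]. *)
have -> : v 0 2 = m%:R * 0 + c%:R * (v 0 2 / c%:R).
  by rewrite mulr0 add0r mulrC divfK// pnatr_eq0 -lt0n.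
rewrite -reeve_comb; apply: affine_hull_fin; first by move=> b; exists b.
exact: sum_reeve_weight.
Qed.

Lemma integer_points_point3 x y z :
  @integer_points R 3 (point3 x y z) <->
  [/\ x \is a Num.int, y \is a Num.int & z \is a Num.int].
Proof.
split=> [intv | [intx inty intz]]; last first.
  by move=> [[|[|[|//]]] lt_j3]; rewrite mxE.
by split; [have := intv 0 | have := intv 1 | have := intv 2]; rewrite mxE.
Qed.

End ReevePrism.

(** * Lattice points of the dilated Reeve prism *)

Section ReeveEhrhart.

Context {R : realType} (c m M : nat).
Hypotheses (c_gt0 : (0 < c)%N) (def_m : m = (6 * M)%N).

Let P : set 'rV[R]_3 := reeve_prism c m.

(** The number of lattice points in the column over [p]; truncated subtraction gives
    [max (0, x + y - t)]. *)
Let height (t : nat) (p : 'I_t.+1 * 'I_t.+1) : nat :=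
  (c * t + m * (minn p.1 p.2 - (p.1 + p.2 - t))).+1.

Let point (t : nat) (q : {p : 'I_t.+1 * 'I_t.+1 & 'I_(height p)}) : 'rV[R]_3 :=
  point3 (tag q).1%:R (tag q).2%:R
    (m * ((tag q).1 + (tag q).2 - t) + tagged q)%:R.

Let point_inj t : injective (@point t).
Proof.
move=> [[i j] k] [[i' j'] k'] eq_pt.
have /eqP := congr1 (fun v : 'rV[R]_3 => v 0 0) eq_pt.
rewrite !mxE /= eqr_nat => /eqP/val_inj eq_i.
have /eqP := congr1 (fun v : 'rV[R]_3 => v 0 1) eq_pt.
rewrite !mxE /= eqr_nat => /eqP/val_inj eq_j.
subst i' j'.
have /eqP := congr1 (fun v : 'rV[R]_3 => v 0 2) eq_pt.
by rewrite !mxE /= eqr_nat eqn_add2l => /eqP/val_inj ->.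
Qed.

(** The inequalities of the prism, scaled by [t]; truncated subtraction merges the two lower
    bounds. *)
Let in_dilate t (X Y Z : nat) : (0 < t)%N ->
  dilate t P (point3 X%:R Y%:R Z%:R) <->
  [/\ (X <= t)%N, (Y <= t)%N, (m * (X + Y - t) <= Z)%N &
      (Z <= c * t + m * minn X Y)%N].
Proof.
move=> t_gt0; have t0 : 0 < t%:R :> R by rewrite ltr0n.
have tN0 : t%:R != 0 :> R by rewrite gt_eqF.
have -> : dilate t P (point3 X%:R Y%:R Z%:R) <->
    @reeve_region R c m (X%:R / t%:R) (Y%:R / t%:R) (Z%:R / t%:R).
  split=> [[v Pv def_v]|].
    apply/(reeve_prismP m c_gt0).
    have <- // : v = point3 (X%:R / t%:R) (Y%:R / t%:R) (Z%:R / t%:R).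
    by rewrite ![_ / t%:R]mulrC -scale_point3 -def_v scalerA mulVf// scale1r.
  move/(reeve_prismP m c_gt0) => Pv; eexists; first exact: Pv.
  by rewrite scale_point3 ![t%:R * _]mulrC !divfK.
have leE (a b : nat) : (a%:R / t%:R <= b%:R / t%:R :> R) = (a <= b)%N.
  by rewrite ler_pM2r ?invr_gt0// ler_nat.
have lt1 a : (a%:R / t%:R <= 1 :> R) = (a <= t)%N.
  by rewrite -(leE a t) divff.
have ge0 (a : nat) : 0 <= a%:R / t%:R :> R by rewrite divr_ge0.
have upper a : (Z%:R / t%:R <= c%:R + m%:R * (a%:R / t%:R) :> R)
    = (Z <= c * t + m * a)%N.
  by rewrite -leE natrD !natrM mulrDl mulrA mulfK.
have lower : (m%:R * (X%:R / t%:R + Y%:R / t%:R - 1) <= Z%:R / t%:R :> R)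
    = (m * (X + Y) <= Z + m * t)%N.
  rewrite -leE !(natrD, natrM) [(Z%:R + _) / _]mulrDl mulfK// -lerBlDr.
  by rewrite mulrBr mulr1 -mulrDl mulrA.
rewrite /reeve_region !ge0 !lt1 lower !upper /=.
split=> [[Xt Yt _ lo [upX upY]]|[Xt Yt lo up]].
  split=> //; last by rewrite /minn; case: ifP.
  by rewrite mulnBr leq_subLR (addnC (m * t)).
split=> //; first by rewrite (addnC Z) -leq_subLR -mulnBr.
by split; apply: leq_trans up _;
  rewrite leq_add2l leq_mul2l ?geq_minl ?geq_minr orbT.
Qed.

(** Summing over columns gives [(t + 1)^2 (c t + 1)] plus [m] times the sum of the tetrahedron
    heights, which is [(t^3 - t) / 6]; as [m = 6 M], the latter part is [M (t^3 - t)]. *)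
Lemma ehrhart_reeve_prism :
  is_ehrhart_polynomial P
    (1 + (2 + c%:R - M%:R) *: 'X + (1 + 2 * c%:R) *: 'X^2
     + (c%:R + M%:R) *: 'X^3).
Proof.
move=> t t_gt0; exists #|{: {p : 'I_t.+1 * 'I_t.+1 & 'I_(height p)}}|.
  rewrite /ehrhart_count.
  suff -> : dilate t P `&` @integer_points R 3 = range (@point t).
    exact/card_range_inj/point_inj.
  apply/seteqP; split=> [v [tPv intv]|_ [[[i j] k] _ <-]]; last first.
    split; last by apply/integer_points_point3; split; apply: natr_int.
    apply/in_dilate => //=; have := ltn_ord k; rewrite [X in (_ < X)%N]/height /=.
    have := ltn_ord i; have := ltn_ord j => lt_j lt_i lt_k.
    split=> //; first exact: leq_addr.
    have le_min : (i + j - t <= minn i j)%N by lia.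
    rewrite -[X in (_ <= _ + _ * X)%N](subnKC le_min) mulnDr; lia.
  have [w Pw def_v] := tPv.
  have [[/andP[w0 _] /andP[w1 _] w2 _ _]] :
    reeve_region c m (w 0 0) (w 0 1) (w 0 2).
    by apply/reeve_prismP => //; rewrite point3K.
  have nat_coord j : 0 <= w 0 j -> exists n, v 0 j = n%:R.
    by move=> wj; apply/natrP; rewrite natrEint intv -def_v mxE mulr_ge0.
  have [X defX] := nat_coord _ w0; have [Y defY] := nat_coord _ w1.
  have [Z defZ] := nat_coord _ w2.
  move: tPv; rewrite -(point3K v) defX defY defZ => /in_dilate[]// Xt Yt lo up.
  pose p : 'I_t.+1 * 'I_t.+1 :=
    (Ordinal (Xt : X < t.+1)%N, Ordinal (Yt : Y < t.+1)%N).
  have lt_h : (Z - m * (X + Y - t) < height p)%N.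
    by rewrite /height /= ltnS leq_subLR addnCA -mulnDr subnKC//; lia.
  exists (Tagged (fun p => 'I_(height p)) (Ordinal lt_h)) => //.
  by rewrite /point /= subnKC.
rewrite card_tagged sumnE big_map big_enum /=.
under eq_bigr do rewrite card_ord.
rewrite -(pair_bigA _ (fun i j => height (i, j)))/= /height /=.
have -> : (\sum_(i < t.+1) \sum_(j < t.+1)
    (c * t + m * (minn i j - (i + j - t))).+1 =
    t.+1 * t.+1 * (c * t).+1 +
    m * \sum_(i < t.+1) \sum_(j < t.+1) (minn i j - (i + j - t)))%N.
  rewrite big_distrr /= -[in RHS]mulnA.
  under [in RHS]eq_bigr do rewrite big_distrr /=.
  rewrite -[X in (X * _ + _)%N]card_ord -sum_nat_const -big_split.
  apply: eq_bigr => i _ /=.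
  rewrite -[X in (X * _ + _)%N]card_ord -sum_nat_const -big_split.
  by apply: eq_bigr => j _ /=; rewrite addSn.
have := congr1 (fun n => n%:R : rat) (sum_height_square t).
rewrite def_m -(mulnA 6%N) (mulnCA 6%N) /=; set G := (6 * _)%N => defG.
have -> : (t.+1 * t.+1 * (c * t).+1 + M * G)%:R
    = (t%:R + 1) * (t%:R + 1) * (c%:R * t%:R + 1)
      + M%:R * (t%:R ^+ 3 - t%:R) :> rat.
  rewrite -natrX -defG [X in _ * (X - _)]natrD addrK.
  by rewrite natrD !natrM -!natr1 natrM.
by rewrite !hornerE /=; ring.
Qed.

Lemma spanning_reeve_prism :
  spanning_lattice_polytope P
    (1 + (2 + c%:R - M%:R) *: 'X + (1 + 2 * c%:R) *: 'X^2
     + (c%:R + M%:R) *: 'X^3).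
Proof.
split; first exact: ehrhart_reeve_prism.
exists (range (reeve_vertex c m)); split=> //.
- by apply: finite_image; apply: finite_finset.
- move=> _ [b _ <-]; apply/integer_points_point3.
  by split; rewrite -?natrM -?natrD natr_int.
- exact: affine_hull_reeve.
Qed.

End ReeveEhrhart.

(** * Coefficients of a cubic times [(n X + 1)^e] *)

Section Coefficients.

Lemma coef_linear_exp (n e j : nat) :
  ((n%:R *: 'X + 1 : {poly rat}) ^+ e)`_j = ('C(e, j) * n ^ j)%:R.
Proof.
elim: e j => [|e IHe] j.
  by rewrite expr0 coef1 bin0n; case: j => // j; rewrite mul0n.
rewrite exprS mulrDl mul1r coefD -scalerAl coefZ coefXM !IHe.
case: j => [|j] /=; first by rewrite mulr0 add0r !bin0.
by rewrite binS -natrM -natrD expnS; congr (_%:R)%R; lia.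
Qed.

Lemma coef_cubic_mul (f1 f2 f3 : rat) (q : {poly rat}) (j : nat) :
  ((1 + f1 *: 'X + f2 *: 'X^2 + f3 *: 'X^3) * q)`_j =
  q`_j + f1 * (if (j < 1)%N then 0 else q`_(j - 1))
       + f2 * (if (j < 2)%N then 0 else q`_(j - 2))
       + f3 * (if (j < 3)%N then 0 else q`_(j - 3)).
Proof.
rewrite -['X]expr1 !mulrDl mul1r -!scalerAl !coefD !coefZ !coefXnM.
by [].
Qed.

Local Open Scope nat_scope.

(** This bound and the next follow from [(k + 1) 'C(e, k + 1) = (e - k) 'C(e, k)]; they are crude,
    but only control terms that [n] makes negligible. *)
Lemma bin_succ_le (e k : nat) : 'C(e, k.+1) <= e * 'C(e, k).
Proof.
apply: leq_trans (leq_pmull _ (ltn0Sn k)) _.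
by rewrite mul_bin_left leq_mul2r leq_subr orbT.
Qed.

Lemma bin_le_succ (e k : nat) : k < e -> 'C(e, k) <= e * 'C(e, k.+1).
Proof.
move=> lt_ke; have pos : 0 < e - k by rewrite subn_gt0.
apply: leq_trans (leq_pmull _ pos) _.
by rewrite -mul_bin_left leq_mul2r lt_ke orbT.
Qed.

(** * The chosen constants and the resulting signs *)

Section Constants.

Variables (e n c C : nat).
Hypotheses (e_ge2 : 2 <= e) (def_n : n = 6 * (e * e)) (def_c : c = n * n * n)
  (def_C : C = (e - 1) * (n * n)).

Let n_gt0 : 0 < n.
Proof. by rewrite def_n !muln_gt0; lia. Qed.

(** [A], [B], [D], [E] stand for ['C(e, j)], ['C(e, j - 1)], ['C(e, j - 2)], ['C(e, j - 3)], with
    [n^(j - 3)] divided out; zeros for [D] and [E] cover small [j]. *)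
Lemma linear_coef_dominates (A B D E : nat) :
    0 < B -> A <= e * B -> 3 * D <= (e - 2) * B -> E <= e * e * B ->
  A * (n * n * n) + (1 + 2 * c) * D * n + (2 * c + 2 + C) * E < C * B * (n * n).
Proof.
move=> B_gt0 leA leD leE.
have e4 : 4 <= e * e by apply: (leq_mul e_ge2 e_ge2).
have n_ge3 : 3 <= n by rewrite def_n; lia.
(* A common bound for the four lower-order terms, in [t1] to [t4]. *)
pose T := e * e * e * (n * n * n).
have T_gt0 : 0 < T by rewrite !muln_gt0; lia.
have t1 : 3 * e * (n * n * n) <= T.
  by rewrite leq_mul// leq_mul//; lia.
have t2 : (e - 2) * n <= T.
  rewrite leq_mul//; last by rewrite leq_pmull// muln_gt0; lia.
  by rewrite (leq_trans (leq_subr _ _))// leq_pmull//; lia.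
have t3 : 6 * (e * e) <= T.
  rewrite -def_n -[leqLHS]mul1n leq_mul//; last by rewrite leq_pmull// muln_gt0; lia.
  by rewrite !muln_gt0; lia.
have t4 : 3 * (e - 1) * (n * n) * (e * e) <= T.
  have -> : T = n * e * (n * n) * (e * e) by rewrite /T; lia.
  by rewrite leq_mul// leq_mul// leq_mul// leq_subr.
(* The leading terms leave the margin [3 (e - 1) n^4 - 2 (e - 2) n^4 = (e + 1) n^4]. By the choice
   of [n] this is [6 T + 6 e^2 n^3]: the second summand absorbs [6 c e^2], and [6 T] exceeds the
   four remaining terms. *)
have key : 3 * e * (n * n * n) + (1 + 2 * c) * (e - 2) * n
    + 3 * (2 * c + 2 + C) * (e * e) < 3 * C * (n * n).
  have def_n4 : (e + 1) * (n * n * n * n) = 6 * T + 6 * (e * e) * (n * n * n).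
    by rewrite {4}def_n /T; lia.
  have [e' def_e] : exists e', e = e' + 2 by exists (e - 2); lia.
  have e'1 : e - 1 = e' + 1 by lia.
  have e'2 : e - 2 = e' by lia.
  rewrite def_c def_C e'1 e'2; rewrite e'1 in t4; rewrite e'2 in t2.
  move: def_n4 t1 t2 t3 t4 T_gt0; move: (T) => T'.
  clear -def_e; subst e; lia.
have keyB : (3 * e * (n * n * n) + (1 + 2 * c) * (e - 2) * n
    + 3 * (2 * c + 2 + C) * (e * e)) * B < 3 * C * (n * n) * B.
  by rewrite ltn_pmul2r.
have leA' := leq_mul leA (leqnn (3 * (n * n * n))).
have leD' := leq_mul leD (leqnn ((1 + 2 * c) * n)).
have leE' := leq_mul leE (leqnn (3 * (2 * c + 2 + C))).
move: keyB leA' leD' leE'; move: (e - 2) (1 + 2 * c) (2 * c + 2 + C) => e' c1 c2.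
clear; lia.
Qed.

(** The case [j = e]. As [2 'C(e, 2) = e (e - 1)], the part [2 c] alone gives equality; the 1 in
    [1 + 2 c] makes it strict. *)
Lemma linear_coef_dominated :
  C * e * n < (1 + 2 * c) * 'C(e, 2).
Proof.
have bin2E : 2 * 'C(e, 2) = e * (e - 1) by rewrite mul_bin_left bin1 mulnC.
rewrite -(ltn_pmul2l (isT : 0 < 2)) (mulnCA 2 (1 + 2 * c)) bin2E def_c def_C.
have : 0 < e * (e - 1) by rewrite muln_gt0; lia.
by move: (e - 1) => e1; lia.
Qed.

(** The case [j = e + 1]: [(e - 1) n^3] against more than [2 e n^3]. *)
Lemma linear_coef_dominated_top : C * n < (1 + 2 * c) * e.
Proof.
rewrite def_c def_C; have := leq_mul (leq_subr 1 e) (leqnn (n * n * n)).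
by move: (e - 1) => e1; lia.
Qed.

(** The choice [M = c + 2 + C] makes the linear coefficient [- C] and the cubic one
    [2 c + 2 + C]. *)
Let f : {poly rat} := (1 + (2 + c%:R - (c + 2 + C)%:R) *: 'X
  + (1 + 2 * c%:R) *: 'X^2 + (c%:R + (c + 2 + C)%:R) *: 'X^3)%R.
Let q : {poly rat} := ((n%:R *: 'X + 1) ^+ e)%R.

Let sub_lt0 (a1 a2 a3 a4 : nat) : a1 + a3 + a4 < a2 ->
  (a1%:R - a2%:R + a3%:R + a4%:R < 0 :> rat)%R.
Proof. by rewrite -(ltr_nat rat) !natrD; lra. Qed.

Let sub_gt0 (a1 a2 a3 a4 : nat) : a2 < a3 ->
  (0 < a1%:R - a2%:R + a3%:R + a4%:R :> rat)%R.
Proof.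
rewrite -(ltr_nat rat) => lt_a.
have := ler0n rat a1; have := ler0n rat a4; lra.
Qed.

(** Casts of naturals with a single minus sign reduce each sign question to an inequality in
    [nat]. *)
Let coef_fq j : ((f * q)`_j =
  ('C(e, j) * n ^ j)%N%:R
  - (C * (if j < 1 then 0 else 'C(e, j - 1) * n ^ (j - 1)))%N%:R
  + ((1 + 2 * c) * (if j < 2 then 0 else 'C(e, j - 2) * n ^ (j - 2)))%N%:R
  + ((2 * c + 2 + C)
      * (if j < 3 then 0 else 'C(e, j - 3) * n ^ (j - 3)))%N%:R)%R.
Proof.
rewrite coef_cubic_mul !coef_linear_exp !(natrM, natrD) -mulNr.
by congr (_ + _ * _ + _ * _ + _ * _)%R;
  first [by case: ifP => _; rewrite ?natrM | ring].
Qed.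

Lemma coef_low_lt0 j : 1 <= j -> j < e -> ((f * q)`_j < 0)%R.
Proof.
move=> j1 je; rewrite coef_fq.
have B_gt0 : 0 < 'C(e, j - 1) by rewrite bin_gt0; lia.
have leA : 'C(e, j) <= e * 'C(e, j - 1).
  by have := bin_succ_le e (j - 1); rewrite subn1 prednK.
(* Here [i = j - 2], so [j < e] gives both [3 <= e - i] and [i + 1 <= e - 2]. *)
have leD i : i.+1 = j - 1 -> 3 * 'C(e, i) <= (e - 2) * 'C(e, j - 1).
  move=> def_i; apply: leq_trans (_ : (e - i) * 'C(e, i) <= _).
    by rewrite leq_mul2r; apply/orP; right; lia.
  by rewrite -mul_bin_left -def_i leq_mul2r; apply/orP; right; lia.
have leE i : i.+2 = j - 1 -> 'C(e, i) <= e * e * 'C(e, j - 1).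
  move=> def_i; rewrite -mulnA.
  apply: leq_trans (bin_le_succ (_ : i < e)) _; first by lia.
  by rewrite leq_mul2l -def_i bin_le_succ ?orbT//; lia.
apply: sub_lt0.
(* For [j = 1] and [j = 2] the absent terms are 0 and the general bound has a spare factor [n * n]
   or [n]; for [j >= 3] it is multiplied by [n^(j - 3)]. *)
case: j j1 je B_gt0 leA leD leE => [|[|[|i]]] j1 _ B_gt0 leA leD leE.
- by [].
- have := @linear_coef_dominates _ _ 0 0 B_gt0 leA isT isT.
  have nn_gt0 : 0 < n * n by rewrite muln_gt0 n_gt0.
  rewrite !muln0 mul0n !addn0 -(mulnA n) mulnA (ltn_pmul2r nn_gt0) /=.
  by rewrite subnn expn1 expn0 muln1.
- have := @linear_coef_dominates _ _ 'C(e, 0) 0 B_gt0 leA (leD 0 erefl) isT => key.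
  rewrite /= !subSS !subn0 in key *.
  by rewrite !expnS !expn0 -(ltn_pmul2r n_gt0); lia.
have key := linear_coef_dominates B_gt0 leA (leD i.+1 erefl) (leE i erefl).
rewrite /= !subSS !subn0 !expnS in key *.
have ni_gt0 : 0 < n ^ i by rewrite expn_gt0 n_gt0.
by rewrite -(ltn_pmul2r ni_gt0) in key; move: (n ^ i) key => ni; lia.
Qed.

Let bin_pred : 'C(e, e - 1) = e.
Proof. by rewrite bin_sub ?bin1//; lia. Qed.

Lemma coef_top_gt0 : (0 < (f * q)`_e.+1)%R.
Proof.
have [lt1 lt2] : (e.+1 < 1) = false /\ (e.+1 < 2) = false by lia.
rewrite coef_fq; apply: sub_gt0; rewrite lt1 lt2 !subSS subn0 binn mul1n bin_pred.
have -> : n ^ e = n * n ^ (e - 1) by rewrite -expnS; congr (_ ^ _); lia.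
by rewrite !mulnA ltn_pmul2r ?linear_coef_dominated_top// expn_gt0 n_gt0.
Qed.

Lemma coef_next_gt0 : (0 < (f * q)`_e)%R.
Proof.
have [lt1 lt2] : (e < 1) = false /\ (e < 2) = false by lia.
rewrite coef_fq; apply: sub_gt0; rewrite lt1 lt2 bin_pred bin_sub//.
have -> : n ^ (e - 1) = n * n ^ (e - 2) by rewrite -expnS; congr (_ ^ _); lia.
by rewrite !mulnA ltn_pmul2r ?linear_coef_dominated// expn_gt0 n_gt0.
Qed.

End Constants.
End Coefficients.

(** * Assembly of the polytope in dimension [d] *)

Theorem theorem3p3 (R : realType) (d : nat) (hd : (4 <= d)%N) :
  exists (N : nat) (P : set 'rV[R]_N) (p : {poly rat}),
    [/\ is_integral_polytope P,
        has_dimension P d,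
        is_ehrhart_polynomial P p,
        0 < p`_(d - 2)%N /\ 0 < p`_(d - 3)%N &
        forall j : nat, (1 <= j)%N -> (j < d - 3)%N -> p`_j < 0].
Proof.
have [e def_d] : exists e, d = (e + 3)%N by exists (d - 3)%N; lia.
have e_gt0 : (0 < e)%N by lia.
have -> : (d - 2 = e.+1)%N by lia.
have -> : (d - 3 = e)%N by lia.
rewrite {hd}def_d; exists (e + 3)%N.
have build c M n : (0 < c)%N -> (0 < n)%N ->
    let p : {poly rat} := (1 + (2 + c%:R - M%:R) *: 'X + (1 + 2 * c%:R) *: 'X^2
              + (c%:R + M%:R) *: 'X^3) * (n%:R *: 'X + 1) ^+ e in
    [/\ 0 < p`_e.+1, 0 < p`_e & forall j, (1 <= j)%N -> (j < e)%N -> p`_j < 0] ->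
    exists (P : set 'rV[R]_(e + 3)) (p : {poly rat}),
      [/\ is_integral_polytope P, has_dimension P (e + 3),
          is_ehrhart_polynomial P p, 0 < p`_e.+1 /\ 0 < p`_e &
          forall j, (1 <= j)%N -> (j < e)%N -> p`_j < 0].
  move=> c_gt0 n_gt0 p [top next low].
  (* The height left open is fixed as [6 * M] by [erefl]. *)
  have slP := @spanning_reeve_prism R c _ M c_gt0 erefl.
  have [Q slQ] := spanning_lattice_polytope_prisms e n_gt0 slP.
  have [? ? ?] := spanning_lattice_polytopeP slQ.
  by exists Q, p.
have [e_ge2|e_le1] := leqP 2 e; last first.
  have e1 : e = 1%N by lia.
  (* With [c = n = 1] and [M = 0] the product is the unit cube of dimension 4, and the range
     [1 <= j < 1] is empty. *)
  subst e; apply: (build 1%N 0%N 1%N) => //.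
  rewrite !coef_cubic_mul !coef_linear_exp.
  by split=> // j j1; rewrite ltnNge j1.
pose n := (6 * (e * e))%N; pose c := (n * n * n)%N.
pose C := ((e - 1) * (n * n))%N.
have n_gt0 : (0 < n)%N by rewrite !muln_gt0 e_gt0.
apply: (build c (c + 2 + C)%N n) => //; first by rewrite /c 2!muln_gt0 n_gt0.
split.
- exact: coef_top_gt0.
- exact: coef_next_gt0.
- by move=> j; apply: coef_low_lt0.
Qed.
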